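(* Let $X$ be a complex Hilbert space and let $S, T$ be Hermitian linear relations in $X$ with $D(T)\subset D(S)$ and $S(0)\subset T(0)$. If $S$ is $T$-bounded with $T$-bound less than $1$, then $T+S$ is self-adjoint if and only if $T$ is self-adjoint.
   Context: $X$ is a complex Hilbert space with inner product $\langle\cdot,\cdot\rangle$. A linear relation in $X$ is a linear subspace $T$ of $X\times X$. Its domain is $D(T)=\{x\in X: (x,f)\in T \text{ for some } f\in X\}$, and for $x\in D(T)$ (in particular $x=0$), $T(x)=\{f\in X:(x,f)\in T\}$. The sum of two linear relations is $T+S=\{(x,f+g):(x,f)\in T,\ (x,g)\in S\}$. The adjoint is $T^*=\{(y,g)\in X\times X:\langle g,x\rangle=\langle y,f\rangle \text{ for all } (x,f)\in T\}$. $T$ is Hermitian if $T\subset T^*$ and self-adjoint if $T=T^*$. Norm of a relation at a point: let $Q_T: X\to X/\overline{T(0)}$ be the natural quotient map, where $X/\overline{T(0)}$ carries the quotient norm. Then $\tilde T_s=Q_T T$ is a single-valued linear operator with domain $D(T)$, and for $x\in D(T)$ one sets $\|T(x)\|:=\|\tilde T_s(x)\|$; equivalently, $\|T(x)\|$ is the distance from $y$ to $\overline{T(0)}$ for any $y\in T(x)$. Relative boundedness: $S$ is $T$-bounded if $D(T)\subset D(S)$ and there is a constant $c\ge 0$ with $\|S(x)\|\le c(\|x\|+\|T(x)\|)$ for all $x\in D(T)$. In that case the $T$-bound of $S$ is the infimum of all $b\ge 0$ for which there exists $a\ge 0$ such that $\|S(x)\|\le a\|x\|+b\|T(x)\|$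 for all $x\in D(T)$. *)

(* Defs.v *)
From HB Require Import structures.
From mathcomp Require Import all_boot all_order all_algebra.
From mathcomp Require Import complex.
From mathcomp Require Import all_classical all_reals all_analysis.

Set Implicit Arguments.
Unset Strict Implicit.
Unset Printing Implicit Defensive.

Import Order.TTheory GRing.Theory Num.Theory Num.Def.
Import numFieldNormedType.Exports.

Local Open Scope classical_set_scope.
Local Open Scope ring_scope.
Local Open Scope complex_scope.

(* A complex Hilbert space is a complete normed module [X] over [R[i]] together
   with a positive definite Hermitian form [ip], linear in its first argument,
   that induces the norm of [X]. *)
Definition induces_norm (R : realType) (X : completeNormedModType R[i])
    (ip : {dot X for conjC}) : Prop :=
  forall x : X, `|x| ^+ 2 = ip x x.

Section LinearRelations.
Variables (R : realType) (X : completeNormedModType R[i]).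
Implicit Types S T : set (X * X).

(* The norm of an [R[i]]-module is [R[i]]-valued, with values on the
   nonnegative real axis; [rnorm] reads it as an element of [R]. *)
Definition rnorm (x : X) : R := complex.Re `|x|.

Definition linear_relation T : Prop :=
  [/\ T (0, 0),
      forall p q, T p -> T q -> T (p + q) &
      forall (a : R[i]) p, T p -> T (a *: p)].

Definition rel_dom T : set X := [set x | exists f, T (x, f)].

Definition rel_at T (x : X) : set X := [set f | T (x, f)].

Definition rel_add T S : set (X * X) :=
  [set p | exists f g, [/\ T (p.1, f), S (p.1, g) & p.2 = f + g]].

Definition adjoint (ip : {dot X for conjC}) T : set (X * X) :=
  [set q | forall x f, T (x, f) -> ip q.2 x = ip q.1 f].

Definition hermitian_rel (ip : {dot X for conjC}) T : Prop :=
  T `<=` adjoint ip T.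

Definition selfadjoint_rel (ip : {dot X for conjC}) T : Prop :=
  T = adjoint ip T.

(* The elements of the quotient space [X / N] are represented as the cosets of
   [N], i.e. as subsets of [X]. *)
Definition quotient_map (N : set X) (y : X) : set X := [set y + n | n in N].

Definition quotient_norm (C : set X) : R := inf [set rnorm z | z in C].

(* The values at [x] of the relation [Q_T T], a singleton when [T] is a linear
   relation and [x] is in its domain (see [operator_values1]). *)
Definition operator_values T (x : X) : set (set X) :=
  [set quotient_map (closure (rel_at T 0)) y | y in rel_at T x].

(* The single-valued operator induced by [Q_T T]; the default value [set0] is
   only taken outside of [rel_dom T]. *)
Definition operator_part T (x : X) : set X := xget set0 (operator_values T x).

Definition rel_norm T (x : X) : R := quotient_norm (operator_part T x).

Definition rel_bounded S T : Prop :=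
  rel_dom T `<=` rel_dom S /\
  exists2 c : R, 0 <= c &
    forall x, rel_dom T x -> rel_norm S x <= c * (rnorm x + rel_norm T x).

Definition rel_bound S T : R :=
  inf [set b : R | 0 <= b /\
    exists2 a : R, 0 <= a &
      forall x, rel_dom T x -> rel_norm S x <= a * rnorm x + b * rel_norm T x].

Lemma closure_translate (A : set X) (a : X) :
  (forall z, A z -> A (a + z)) -> forall z, closure A z -> closure A (a + z).
Proof.
move=> aA z clAz B nB.
have shift_cont : (fun u : X => a + u) @ z --> a + z.
  by apply: cvgD; [exact: cvg_cst | exact: cvg_id].
by have [w [Aw Bw]] := clAz _ (shift_cont _ nB); exists (a + w); split; auto.
Qed.

Lemma operator_values1 T x y : linear_relation T -> T (x, y) ->
  operator_values T x = [set quotient_map (closure (rel_at T 0)) y].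
Proof.
move=> [T0 TD TZ] Txy.
have TB u v : T (x, u) -> T (x, v) -> T (0, u - v).
  move=> Tu Tv; have := TD _ _ Tu (TZ (- 1) _ Tv).
  rewrite (_ : (x, u) + - 1 *: (x, v) = (0, u - v))//.
  by rewrite scaleN1r; congr pair => /=; exact: subrr.
have sub u v : T (x, u) -> T (x, v) ->
    quotient_map (closure (rel_at T 0)) u `<=`
    quotient_map (closure (rel_at T 0)) v.
  move=> Tu Tv _ [n Nn <-]; exists (u - v + n); last by rewrite addrA subrKC.
  apply: closure_translate => // z T0z.
  have := TD _ _ (TB _ _ Tu Tv) T0z.
  by rewrite -[((0 : X), u - v) + (0, z)]/(0 + 0, u - v + z) addr0.
apply/seteqP; split=> [_ [u Tu <-]|_ ->]; last by exists y.
by apply/seteqP; split; exact: sub.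
Qed.

Lemma rel_normE T x y : linear_relation T -> T (x, y) ->
  rel_norm T x = inf [set rnorm (y + n) | n in closure (rel_at T 0)].
Proof.
move=> linT Txy; rewrite /rel_norm /operator_part (operator_values1 linT Txy).
rewrite (_ : xget _ _ = quotient_map (closure (rel_at T 0)) y).
  by rewrite /quotient_norm image_comp.
exact: xget_unique.
Qed.

End LinearRelations.

(* Main.v *)
Require Import Defs.
From mathcomp Require Import all_boot all_order all_algebra.
From mathcomp Require Import complex.
From mathcomp Require Import all_classical all_reals all_analysis.
From mathcomp Require Import ring lra.

Set Implicit Arguments.
Unset Strict Implicit.
Unset Printing Implicit Defensive.

Import Order.TTheory GRing.Theory Num.Theory Num.Def.
Import numFieldNormedType.Exports.

Local Open Scope classical_set_scope.
Local Open Scope ring_scope.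
Local Open Scope complex_scope.
(** A hermitian relation [T] is self-adjoint exactly when both [T - i mu] and
   [T + i mu] are onto, for one (equivalently every) real [mu != 0]: see
   [range_selfadjoint] and [selfadjoint_range].  The identity behind this is
   |f - i mu x|^2 = |f|^2 + mu^2 |x|^2 for (x, f) in [T]; it makes the range of
   [T - i mu] closed, so that the projection onto that range detects any missing
   direction [w], and self-adjointness then turns (w, - i mu w) into an element
   of [T] of which the same identity says that [w = 0].

   The same identity bounds |x| by |y| / |mu| and |f| by |y|, where
   y = f - i mu x.  If some g in [B x] has norm nearly a |x| + b |f| with
   [b < 1], then for [mu] large |g| <= q |y| with [q < 1], and the equation
   y + g = z is solved up to elements of [A 0] by a Neumann series
   ([approx_solvable]).  Hence a small hermitian perturbation [B] of a
   self-adjoint [A] with [B 0] inside [A 0] leaves it self-adjoint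
   ([selfadjoint_perturbation]).  The relation [B] is neither single-valued nor
   closed: its values are only controlled modulo [B 0], and this ambiguity is
   absorbed by [A 0], which is closed because [A] equals its adjoint.

   Applied to [A = T] and [B = S] this gives one implication.  For the converse,
   [S] subtracted from [T + S] need not have relative bound below [1], so one
   moves back along the pencil [T + t S]: for [t] in [0, 1] the bound of [S]
   relative to [T + t S] is at most b / (1 - b), uniformly in [t], so finitely
   many equal steps lead from [t = 1] to [t = 0] ([pencil_step]). *)

(** * Norms and convergence *)

Section HilbertSpace.
Variables (R : realType) (X : completeNormedModType R[i]).
Implicit Types (x y : X) (u v : nat -> X) (t : R).

Lemma normE x : `|x| = (rnorm x)%:C.
Proof. by rewrite /rnorm RRe_real// ger0_real. Qed.

Lemma rnorm_ge0 x : 0 <= rnorm x.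
Proof. by rewrite -lecR -normE normr_ge0. Qed.

Lemma rnorm0 : rnorm (0 : X) = 0.
Proof. by rewrite /rnorm normr0. Qed.

Lemma rnorm_eq0 x : rnorm x = 0 -> x = 0.
Proof. by move=> x0; apply/normr0_eq0; rewrite normE x0. Qed.

Lemma rnormN x : rnorm (- x) = rnorm x.
Proof. by rewrite /rnorm normrN. Qed.

Lemma ler_rnormD x y : rnorm (x + y) <= rnorm x + rnorm y.
Proof. by rewrite -lecR rmorphD/= -!normE ler_normD. Qed.

Lemma ler_rnormB x y : rnorm (x - y) <= rnorm x + rnorm y.
Proof. by rewrite -(rnormN y) ler_rnormD. Qed.

Lemma rnormZ t x : rnorm (t%:C *: x) = `|t| * rnorm x.
Proof.
rewrite {1}/rnorm normrZ normE normc_def /= expr0n/= addr0 sqrtr_sqr.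
by rewrite mulr0 subr0.
Qed.

Lemma rnorm_iZ t x : rnorm ((t *i) *: x) = `|t| * rnorm x.
Proof.
rewrite {1}/rnorm normrZ normE normc_def /= expr0n/= add0r sqrtr_sqr.
by rewrite mulr0 subr0.
Qed.

Lemma cvg_rnormP u x : u @ \oo --> x <->
  forall e : R, 0 < e -> exists N, forall n, (N <= n)%N -> rnorm (x - u n) < e.
Proof.
split=> [/cvgrPdist_lt ux e e0|ux].
  have [|N _ Nu] := ux e%:C; first by rewrite ltcR.
  by exists N => n /Nu/=; rewrite normE ltcR.
apply/cvgrPdist_lt => -[e e'] /[dup]; rewrite {1}ltcE/= => /andP[/eqP -> e0] _.
have [N Nu] := ux _ e0; exists N => // n /= /Nu.
by rewrite normE -ltcR.
Qed.

Lemma cauchy_rnorm_cvg u :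
  (forall e : R, 0 < e ->
    exists N, forall m n, (N <= m)%N -> (N <= n)%N -> rnorm (u m - u n) < e) ->
  exists x, u @ \oo --> x.
Proof.
move=> cu; suff /cauchy_cvg : cauchy (u @ \oo).
  by move=> ?; exists (lim (u @ \oo)).
apply/cauchyP => -[e e'] /[dup]; rewrite {1}ltcE/= => /andP[/eqP -> e0] _.
have [N Nu] := cu _ e0; exists (u N); exists N => // n /= Nn.
by rewrite -ball_normE /ball_/= normE ltcR Nu.
Qed.

Lemma cvg_rnorm_cauchy u x : u @ \oo --> x -> forall e : R, 0 < e ->
  exists N, forall m n, (N <= m)%N -> (N <= n)%N -> rnorm (u m - u n) < e.
Proof.
move=> /cvg_rnormP ux e e0; have [|N Nu] := ux (e / 2); first by rewrite divr_gt0.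
exists N => m n Nm Nn; rewrite (_ : u m - u n = (x - u n) - (x - u m)).
  by have := ler_rnormB (x - u n) (x - u m); have := Nu _ Nm; have := Nu _ Nn; lra.
by rewrite opprB [RHS]addrC addrA subrK.
Qed.

Lemma dominated_cvg (C : R) u v x :
  (forall m n, rnorm (v m - v n) <= C * rnorm (u m - u n)) ->
  u @ \oo --> x -> exists y, v @ \oo --> y.
Proof.
move=> vu /cvg_rnorm_cauchy cu; apply: cauchy_rnorm_cvg => e e0.
have C0 : 0 < `|C| + 1 by rewrite ltr_wpDl.
have [|N Nu] := cu (e / (`|C| + 1)); first by rewrite divr_gt0.
exists N => m n Nm Nn; have := Nu m n Nm Nn; rewrite ltr_pdivlMr// mulrC.
apply: le_lt_trans; apply: le_trans (vu m n) _.
by rewrite ler_wpM2r ?rnorm_ge0// (le_trans (ler_norm C))// lerDl.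
Qed.

End HilbertSpace.
(** * The underlying real inner product *)

Lemma Re_conj (R : realType) (c : R[i]) : complex.Re (conjC c) = complex.Re c.
Proof. by case: c. Qed.

Lemma Im_conj (R : realType) (c : R[i]) : complex.Im (conjC c) = - complex.Im c.
Proof. by case: c. Qed.

Lemma ReD (R : realType) (c c' : R[i]) :
  complex.Re (c + c') = complex.Re c + complex.Re c'.
Proof. by case: c c' => [? ?] [? ?]. Qed.

Lemma ReN (R : realType) (c : R[i]) : complex.Re (- c) = - complex.Re c.
Proof. by case: c. Qed.

Section RealInnerProduct.
Variables (R : realType) (X : completeNormedModType R[i]).
Variables (ip : {dot X for conjC}) (ip_norm : induces_norm ip).
Implicit Types (x y z w : X) (t mu : R) (A T S : set (X * X)).

(** All estimates are made with the real part of the inner product, so that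
   inequalities live in the totally ordered field [R]; multiplication by
   imaginary scalars is antisymmetric for it ([rip_iZr]). *)
Definition rip x y : R := complex.Re (ip x y).

Lemma ripC x y : rip x y = rip y x.
Proof. by rewrite /rip (hermC ip x y) expr0 mul1r Re_conj. Qed.

Lemma ripDl x y z : rip (x + y) z = rip x z + rip y z.
Proof. by rewrite /rip linearDl ReD. Qed.

Lemma ripDr x y z : rip x (y + z) = rip x y + rip x z.
Proof. by rewrite ripC ripDl !(ripC x). Qed.

Lemma ripNl x y : rip (- x) y = - rip x y.
Proof. by rewrite /rip linearNl ReN. Qed.

Lemma ripNr x y : rip x (- y) = - rip x y.
Proof. by rewrite ripC ripNl ripC. Qed.

Lemma ripBl x y z : rip (x - y) z = rip x z - rip y z.
Proof. by rewrite ripDl ripNl. Qed.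

Lemma ripBr x y z : rip x (y - z) = rip x y - rip x z.
Proof. by rewrite ripDr ripNr. Qed.

Lemma ripZl t x y : rip (t%:C *: x) y = t * rip x y.
Proof.
by rewrite /rip linearZl_LR/=; case: (ip x y) => a b /=; rewrite mul0r subr0.
Qed.

Lemma ripZr t x y : rip x (t%:C *: y) = t * rip x y.
Proof. by rewrite ripC ripZl ripC. Qed.

Lemma rip_iZl mu x y : rip ((mu *i) *: x) y = - (mu * complex.Im (ip x y)).
Proof.
by rewrite /rip linearZl_LR/=; case: (ip x y) => a b /=; rewrite mul0r sub0r.
Qed.

Lemma rip_iZr mu x y : rip x ((mu *i) *: y) = - rip ((mu *i) *: x) y.
Proof.
rewrite ripC !rip_iZl (hermC ip x y) expr0 mul1r Im_conj.
by rewrite mulrN !opprK.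
Qed.

Lemma rip_rnorm x : rip x x = rnorm x ^+ 2.
Proof. by rewrite /rip -ip_norm normE -rmorphXn. Qed.

Lemma rnormD2 x y : rnorm (x + y) ^+ 2 = rnorm x ^+ 2 + 2 * rip x y + rnorm y ^+ 2.
Proof. by rewrite -!rip_rnorm ripDl !ripDr (ripC y x); ring. Qed.

Lemma rnormB2 x y : rnorm (x - y) ^+ 2 = rnorm x ^+ 2 - 2 * rip x y + rnorm y ^+ 2.
Proof. by rewrite rnormD2 ripNr rnormN; ring. Qed.

(** Cauchy-Schwarz: expand the square of the norm of |y| x - |x| y. *)
Lemma ler_rip x y : rip x y <= rnorm x * rnorm y.
Proof.
have [x0 | x0] := eqVneq (rnorm x) 0.
  by rewrite (rnorm_eq0 x0) rnorm0 mul0r -(scale0r (0 : X)) (ripZl 0) mul0r.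
have [y0 | y0] := eqVneq (rnorm y) 0.
  by rewrite (rnorm_eq0 y0) rnorm0 mulr0 -(scale0r (0 : X)) (ripZr 0) mul0r.
have := sqr_ge0 (rnorm ((rnorm y)%:C *: x - (rnorm x)%:C *: y)).
have {}x0 : 0 < rnorm x by rewrite lt_def x0 rnorm_ge0.
have {}y0 : 0 < rnorm y by rewrite lt_def y0 rnorm_ge0.
rewrite rnormB2 !rnormZ ripZl ripZr !ger0_norm ?rnorm_ge0// => h.
rewrite -(ler_pM2l x0) -(ler_pM2l y0); lra.
Qed.

Lemma ler_normr_rip x y : `|rip x y| <= rnorm x * rnorm y.
Proof.
by rewrite ler_norml lerNl -ripNl ler_rip -(rnormN x) ler_rip.
Qed.

Lemma rip_cvg_eq (u v : nat -> X) x y z w :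
  (forall n, rip (u n) x = rip (v n) y) -> u @ \oo --> z -> v @ \oo --> w ->
  rip z x = rip w y.
Proof.
move=> uv /cvg_rnormP uz /cvg_rnormP vw; apply/eqP; rewrite -subr_eq0 -normr_le0.
apply/ler_addgt0Pr => e e0; rewrite add0r.
pose d := e / (rnorm x + rnorm y + 1).
have k0 : 0 < rnorm x + rnorm y + 1 by rewrite ltr_wpDl ?addr_ge0 ?rnorm_ge0.
have d0 : 0 < d by rewrite divr_gt0.
have [N1 /(_ (maxn N1 _) (leq_maxl _ _)) Nu] := uz _ d0.
have [N2 /(_ (maxn _ N2) (leq_maxr _ _)) Nv] := vw _ d0.
pose n := maxn N1 N2.
rewrite (_ : _ - _ = rip (z - u n) x - rip (w - v n) y); last first.
  by rewrite !ripBl uv; ring.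
apply: le_trans (ler_normB _ _) _; apply: le_trans (lerD _ _) _.
  exact: ler_normr_rip. exact: ler_normr_rip.
have -> : e = d * (rnorm x + rnorm y + 1) by rewrite mulfVK ?gt_eqF.
have := ler_wpM2r (rnorm_ge0 x) (ltW (Nu N2)).
have := ler_wpM2r (rnorm_ge0 y) (ltW (Nv N1)).
by rewrite -/n; lra.
Qed.

(** A minimizing sequence for the distance from [z] to [M] is Cauchy by the
   parallelogram identity; at its limit [m], comparing [m] with [m + t x] for
   real [t] gives the orthogonality. *)
Lemma orthogonal_projection (M : set X) z :
  M 0 -> (forall x y, M x -> M y -> M (x + y)) ->
  (forall t x, M x -> M (t%:C *: x)) ->
  (forall (u : nat -> X) x, (forall n, M (u n)) -> u @ \oo --> x -> M x) ->
  exists2 m, M m & forall x, M x -> rip (z - m) x = 0.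
Proof.
move=> M0 MD MZ Mcl; pose E := [set rnorm (z - m) | m in M].
have MN x : M x -> M (- x).
  by move=> /(MZ (- 1)); rewrite rmorphN1 scaleN1r.
have lbE : lbound E 0 by move=> _ [m _ <-]; exact: rnorm_ge0.
have E0 : has_inf E by split; [exists (rnorm (z - 0)), 0 | exists 0].
pose d := inf E.
have d_le m : M m -> d <= rnorm (z - m)
  by move=> Mm; apply: ge_inf; [exists 0|exists m].
have d0 : 0 <= d by apply: lb_le_inf => //; case: E0.
have approx e : 0 < e -> exists2 m, M m & rnorm (z - m) ^+ 2 < d ^+ 2 + e.
  move=> e0; have s0 : 0 < Num.sqrt (d ^+ 2 + e) - d.
    rewrite subr_gt0 -{1}(ger0_norm d0) -sqrtr_sqr ltr_sqrt; first by lra.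
    by rewrite ltr_wpDl// sqr_ge0.
  have [_ [m Mm <-] lt_m] := inf_adherent s0 E0; exists m => //.
  have k0 : 0 <= d ^+ 2 + e by rewrite addr_ge0 ?sqr_ge0 ?ltW.
  rewrite -(sqr_sqrtr k0) ltr_pXn2r ?nnegrE ?rnorm_ge0 ?sqrtr_ge0//.
  by move: lt_m; rewrite -/d; lra.
have /choice[u Mu] : forall n : nat,
    exists m, M m /\ rnorm (z - m) ^+ 2 < d ^+ 2 + n.+1%:R^-1.
  by move=> n; have [|m ? ?] := approx n.+1%:R^-1; [rewrite invr_gt0|exists m].
have parallelogram x y : M x -> M y ->
    rnorm (x - y) ^+ 2 + 4 * d ^+ 2 <=
      2 * rnorm (z - x) ^+ 2 + 2 * rnorm (z - y) ^+ 2.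
  move=> Mx My; have := d_le _ (MZ 2^-1 _ (MD _ _ Mx My)).
  rewrite -(ler_pXn2r (_ : 0 < 2)%N) ?nnegrE ?rnorm_ge0// => dm.
  suff -> : rnorm (x - y) ^+ 2 = 2 * rnorm (z - x) ^+ 2 + 2 * rnorm (z - y) ^+ 2
     - 4 * rnorm (z - 2^-1%:C *: (x + y)) ^+ 2 by lra.
  rewrite !rnormB2 rnormZ ripZr ger0_norm ?invr_ge0// exprMn rnormD2 ripDr.
  by field.
have inv_natS_small e : 0 < e ->
    exists N, forall n, (N <= n)%N -> n.+1%:R^-1 < e :> R.
  move=> e0; have [N _ Ne] := near_infty_natSinv_lt (PosNum e0).
  by exists N => n /Ne.
have [m um] : exists m : X, u @ \oo --> m.
  apply: cauchy_rnorm_cvg => e e0.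
  have e4 : 0 < e ^+ 2 / 4 by rewrite divr_gt0 ?exprn_gt0.
  have [N small] := inv_natS_small _ e4.
  have le_u n : (N <= n)%N -> rnorm (z - u n) ^+ 2 < d ^+ 2 + e ^+ 2 / 4.
    move=> /small Nn; have [_ un] := Mu n.
    by apply: lt_trans un _; rewrite ltrD2l.
  exists N => m n /le_u um /le_u un.
  rewrite -(ltr_pXn2r (_ : 0 < 2)%N) ?nnegrE ?rnorm_ge0 ?(ltW e0)//.
  by have := parallelogram _ _ (Mu m).1 (Mu n).1; lra.
have Mm : M m by apply: Mcl um => n; case: (Mu n).
exists m => // x Mx.
have zm : rnorm (z - m) <= d.
  apply/ler_addgt0Pr => e e0; have e2 : 0 < e / 2 by rewrite divr_gt0.
  have [N1 /(_ (maxn N1 _) (leq_maxl _ _)) Nu] := (cvg_rnormP _ _).1 um _ e2.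
  have [N2 /(_ (maxn _ N2) (leq_maxr _ _)) small] :=
    inv_natS_small _ (exprn_gt0 2 e2).
  have un : rnorm (z - u (maxn N1 N2)) ^+ 2 < d ^+ 2 + (e / 2) ^+ 2.
    have [_ un] := Mu (maxn N1 N2).
    by apply: lt_trans un _; rewrite ltrD2l small.
  have {}un : rnorm (z - u (maxn N1 N2)) <= d + e / 2.
    rewrite -(ler_pXn2r (_ : 0 < 2)%N) ?nnegrE ?rnorm_ge0 ?addr_ge0 ?(ltW e2)//.
    by have := mulr_ge0 d0 (ltW e2); have := small N1; lra.
  have := ler_rnormB (z - u (maxn N1 N2)) (m - u (maxn N1 N2)).
  by rewrite opprB addrA subrK; have := Nu N2; lra.
have key t : 2 * (t * rip (z - m) x) <= t ^+ 2 * rnorm x ^+ 2.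
  have := d_le _ (MD _ _ Mm (MZ t _ Mx)); rewrite opprD addrA => /(le_trans zm).
  rewrite -(ler_pXn2r (_ : 0 < 2)%N) ?nnegrE ?rnorm_ge0//.
  rewrite (rnormB2 _ (t%:C *: x)) rnormZ ripZr.
  by rewrite exprMn real_normK ?num_real//; lra.
have [x0|x0] := eqVneq (rnorm x) 0.
  by have := key 1; have := key (-1); rewrite x0; lra.
have {}x0 : 0 < rnorm x ^+ 2 by rewrite exprn_gt0// lt_def x0 rnorm_ge0.
apply/eqP; rewrite -sqrf_eq0 eq_le sqr_ge0 andbT.
rewrite -(pmulr_lle0 _ (_ : 0 < (rnorm x ^+ 2)^-1)) ?invr_gt0//.
(* this value of [t] minimizes the quadratic polynomial of [key] *)
have := key (rip (z - m) x / rnorm x ^+ 2).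
set r := rip _ _; set N := rnorm x ^+ 2.
rewrite (_ : (r / N) ^+ 2 * N = r ^+ 2 / N); last by field; rewrite gt_eqF.
by lra.
Qed.

(** * Linear relations and their adjoints *)

Lemma linrelD T x y f g : linear_relation T -> T (x, f) -> T (y, g) ->
  T (x + y, f + g).
Proof. by case=> _ TD _; exact: TD. Qed.

Lemma linrelZ T (c : R[i]) x f : linear_relation T -> T (x, f) ->
  T (c *: x, c *: f).
Proof. by case=> _ _ TZ; exact: TZ. Qed.

Lemma linrelB T x y f g : linear_relation T -> T (x, f) -> T (y, g) ->
  T (x - y, f - g).
Proof.
move=> linT Tx /(linrelZ (- 1) linT); rewrite !scaleN1r; exact: linrelD.
Qed.

(** The real part of the adjunction identity suffices: the imaginary part is
   the real one for (i x, i f). *)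
Lemma adjointP T y g : linear_relation T ->
  adjoint ip T (y, g) <-> forall x f, T (x, f) -> rip g x = rip y f.
Proof.
move=> linT; split=> [Tyg x f /Tyg/= gx|Tyg x f Tx /=].
  by rewrite /rip gx.
have := Tyg _ _ Tx; have := Tyg _ _ (linrelZ (1 *i) linT Tx).
rewrite !rip_iZr !rip_iZl /rip.
by case: (ip g x) (ip y f) => [a b] [c d] /=; rewrite !opprK !mul1r => -> ->.
Qed.

Lemma adjoint_linear T : linear_relation (adjoint ip T).
Proof.
split=> [x f _ /=|[y g] [y' g'] Ty Ty' x f Txf|c [y g] Ty x f Txf].
- by rewrite !linear0l.
- rewrite -[LHS]/(ip (g + g') x) -[RHS]/(ip (y + y') f) !linearDl.
  by congr (_ + _); [exact: Ty Txf|exact: Ty' Txf].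
- rewrite -[LHS]/(ip (c *: g) x) -[RHS]/(ip (c *: y) f) !linearZl_LR.
  by congr (_ * _); exact: Ty Txf.
Qed.

Definition seq_closed_rel T := forall (u v : nat -> X) x f,
  (forall n, T (u n, v n)) -> u @ \oo --> x -> v @ \oo --> f -> T (x, f).

Lemma adjoint_closed T : linear_relation T -> seq_closed_rel (adjoint ip T).
Proof.
move=> linT u v x f Tuv ux vf; apply/adjointP => // y g Ty.
by apply: rip_cvg_eq vf ux => n; apply: (adjointP _ _ linT).1 (Tuv n) _ _ Ty.
Qed.

(** The cross term is the real part of <f, i mu x>, which vanishes because
   <f, x> = <x, f> is real. *)
Lemma hermitian_rnorm2 T mu x f : linear_relation T -> hermitian_rel ip T ->
  T (x, f) ->
  rnorm (f - (mu *i) *: x) ^+ 2 = rnorm f ^+ 2 + mu ^+ 2 * rnorm x ^+ 2.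
Proof.
move=> linT hT Txf; have /adjointP - /(_ linT) fx := hT _ Txf.
have h0 : rip f ((mu *i) *: x) = 0.
  have := fx _ _ (linrelZ (mu *i) linT Txf).
  by rewrite [in RHS]rip_iZr (ripC (_ *: x) f); lra.
by rewrite rnormB2 h0 rnorm_iZ exprMn real_normK ?num_real//; ring.
Qed.

Lemma hermitian_ge_rnorm T mu x f : linear_relation T -> hermitian_rel ip T ->
  T (x, f) -> rnorm f <= rnorm (f - (mu *i) *: x) /\
    `|mu| * rnorm x <= rnorm (f - (mu *i) *: x).
Proof.
move=> linT hT Txf; have E := hermitian_rnorm2 mu linT hT Txf.
split; rewrite -(ler_pXn2r (_ : 0 < 2)%N) ?nnegrE ?mulr_ge0 ?rnorm_ge0//.
  by rewrite E lerDl mulr_ge0 ?sqr_ge0.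
by rewrite E exprMn real_normK ?num_real// lerDr sqr_ge0.
Qed.

(** * Self-adjointness and ranges *)

(** The range is closed, since x and f are controlled by f - i mu x, and a
   vector [w] orthogonal to it satisfies (w, - i mu w) in [T], hence [w = 0] by
   the lower bound for [- mu]. *)
Lemma selfadjoint_range T mu : linear_relation T -> selfadjoint_rel ip T ->
  mu != 0 -> forall z, exists x f, T (x, f) /\ f - (mu *i) *: x = z.
Proof.
move=> linT saT mu0 z.
have hT : hermitian_rel ip T by rewrite /hermitian_rel -saT.
pose M := [set y | exists x f, T (x, f) /\ f - (mu *i) *: x = y].
have [m [x [f [Txf <-]]] perp] :
    exists2 m, M m & forall y, M y -> rip (z - m) y = 0.
  apply: orthogonal_projection.
  - by exists 0, 0; rewrite scaler0 subr0; case: linT.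
  - move=> _ _ [x [f [Tx <-]]] [y [g [Ty <-]]]; exists (x + y), (f + g).
    by split; [exact: linrelD|rewrite scalerDr opprD addrACA].
  - move=> t _ [x [f [Tx <-]]]; exists (t%:C *: x), (t%:C *: f).
    by split; [exact: linrelZ|rewrite scalerBr !scalerA mulrC].
  - move=> u y /choice[x /choice[f Tu]] uy.
    have D n n' : T (x n - x n', f n - f n') /\
        (f n - f n') - (mu *i) *: (x n - x n') = u n - u n'.
      have [[Tn <-] [Tn' <-]] := (Tu n, Tu n'); split; first exact: linrelB.
      by rewrite scalerBr !opprD !opprK addrACA.
    have [x' xx'] : exists x' : X, x @ \oo --> x'.
      apply: (dominated_cvg (C := `|mu|^-1)) uy => n n'.
      have [Tnn' <-] := D n n'.
      rewrite ler_pdivlMl ?normr_gt0//.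
      by case: (hermitian_ge_rnorm mu linT hT Tnn').
    have [f' ff'] : exists f' : X, f @ \oo --> f'.
      apply: (dominated_cvg (C := 1)) uy => n n'; have [Tnn' <-] := D n n'.
      by rewrite mul1r; case: (hermitian_ge_rnorm mu linT hT Tnn').
    exists x', f'; split.
      rewrite saT; apply: (adjoint_closed linT) xx' ff' => n.
      by rewrite -saT; case: (Tu n).
    have : u @ \oo --> f' - (mu *i) *: x'.
      rewrite (_ : u = (fun n => f n - (mu *i) *: x n)); last first.
        by apply/funext => n; case: (Tu n).
      by apply: cvgB => //; exact: cvgZl_tmp.
    by move=> lim; apply: (cvg_unique _ lim uy); exact: norm_hausdorff.
set w := z - _ in perp; suff w0 : w = 0.
  by exists x, f; split=> //; apply/eqP; rewrite eq_sym -subr_eq0; apply/eqP.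
have Tw : T (w, ((- mu) *i) *: w).
  rewrite saT; apply/adjointP => // y g Ty.
  have := perp _ (ex_intro _ y (ex_intro _ g (conj Ty erefl))).
  rewrite ripBr rip_iZr !rip_iZl; lra.
have [_] := hermitian_ge_rnorm (- mu) linT hT Tw.
rewrite subrr rnorm0 pmulr_rle0 ?normr_gt0 ?oppr_eq0// => w0.
by apply/rnorm_eq0/eqP; rewrite eq_le w0 rnorm_ge0.
Qed.

(** Given (y, g) in the adjoint, surjectivity for [mu] gives (x, f) in [T] such
   that [w = y - x] has (w, i mu w) in the adjoint; so [w] is orthogonal to the
   range for [- mu], which is everything. *)
Lemma range_selfadjoint T mu : linear_relation T -> hermitian_rel ip T ->
  (forall z, exists x f, T (x, f) /\ f - (mu *i) *: x = z) ->
  (forall z, exists x f, T (x, f) /\ f - ((- mu) *i) *: x = z) ->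
  selfadjoint_rel ip T.
Proof.
move=> linT hT ran ranN; apply/seteqP; split=> // -[y g] Tyg.
have [x [f [Txf fx]]] := ran (g - (mu *i) *: y).
have Tw := linrelB (adjoint_linear T) Tyg (hT _ Txf).
have gf : g - f = (mu *i) *: (y - x).
  rewrite -[f](subrK ((mu *i) *: x)) fx scalerBr opprD opprB addrA.
  by rewrite addrCA subrr addr0.
have [u [h [Tuh uh]]] := ranN (y - x).
have := (adjointP _ _ linT).1 Tw _ _ Tuh.
rewrite gf => gu; have yx0 : rip (y - x) (y - x) = 0.
  rewrite -[X in rip _ X]uh ripBr rip_iZr -gu !rip_iZl; ring.
have /rnorm_eq0 w0 : rnorm (y - x) = 0.
  by apply/eqP; rewrite -sqrf_eq0 -rip_rnorm yx0.
by rewrite -[y](subrK x) -[g](subrK f) gf w0 scaler0 !add0r.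
Qed.
(** * Small perturbations *)

(** Solve approximately, then solve for the remainder, and so on: the remainders
   decay like [q ^+ k], so the partial sums of the approximate solutions
   converge and closedness of [G] passes to the limit.  The
   approximate solutions are merely chosen, so [G] may be multivalued. *)
Lemma approx_solvable (G : set (X * X)) (C q : R) :
  G (0, 0) -> (forall p p', G p -> G p' -> G (p + p')) -> seq_closed_rel G ->
  0 <= C -> 0 <= q < 1 ->
  (forall z, exists y z', [/\ G (y, z'), rnorm y <= C * rnorm z &
                              rnorm (z - z') <= q * rnorm z]) ->
  forall z, exists y, G (y, z).
Proof.
move=> G0 GD Gcl C0 /andP[q0 q1] /choice[Y /choice[Z YZ]] z.
pose r := fix r k := if k is k'.+1 then r k' - Z (r k') else z.
pose P k := \sum_(i < k) Y (r i).
have r_le k : rnorm (r k) <= q ^+ k * rnorm z.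
  elim: k => [|k IH]; first by rewrite expr0 mul1r.
  have [_ _ /le_trans] := YZ (r k); apply.
  by rewrite exprS -mulrA ler_wpM2l.
have GP k : G (P k, z - r k).
  elim: k => [|k IH]; first by rewrite /P big_ord0 subrr.
  have [Gk _ _] := YZ (r k); have := GD _ _ IH Gk.
  rewrite (_ : _ + _ = (P k.+1, z - r k.+1))//; congr pair => /=.
    by rewrite /P big_ord_recr.
  by rewrite opprB addrCA addrC addrAC.
pose K := C * rnorm z.
have K0 : 0 <= K by rewrite mulr_ge0 ?rnorm_ge0.
have q1' : 0 < 1 - q by rewrite subr_gt0.
(* the right-hand side telescopes, [K * (1 - q) * q ^+ i] being one step *)
have PB n k : (1 - q) * rnorm (P (n + k)%N - P n) <= K * (q ^+ n - q ^+ (n + k)).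
  elim: k => [|k IH]; first by rewrite addn0 !subrr rnorm0 !mulr0.
  have -> : P (n + k.+1)%N - P n = (P (n + k)%N - P n) + Y (r (n + k)%N).
    by rewrite addnS /P big_ord_recr/= addrAC.
  have Yk : rnorm (Y (r (n + k)%N)) <= K * q ^+ (n + k).
    have [_ /le_trans + _] := YZ (r (n + k)%N); apply.
    by rewrite /K mulrAC -mulrA ler_wpM2l.
  have := ler_wpM2l (ltW q1') (ler_rnormD (P (n + k)%N - P n) (Y (r (n + k)%N))).
  have := ler_wpM2l (ltW q1') Yk.
  by rewrite addnS exprS; lra.
have q_small e : 0 < e -> exists N, forall n, (N <= n)%N -> q ^+ n < e.
  move=> e0; have : (fun n => q ^+ n) @ \oo --> (0 : R).
    by apply: cvg_expr; rewrite ger0_norm.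
  move=> /cvgrPdist_lt/(_ _ e0)[N _ Nq]; exists N => n /Nq/=.
  by rewrite sub0r normrN ger0_norm ?exprn_ge0.
have [y Py] : exists y : X, P @ \oo --> y.
  apply: cauchy_rnorm_cvg => e e0.
  have K1 : 0 < 2 * K + 1 by lra.
  have [|N qN] := q_small (e * (1 - q) / (2 * K + 1)).
    by rewrite divr_gt0// mulr_gt0 ?subr_gt0.
  have PN n : (N <= n)%N -> (1 - q) * rnorm (P n - P N) <= K * q ^+ N.
    move=> /subnKC <-; apply: le_trans (PB _ _) _.
    by rewrite ler_wpM2l// lerBlDr lerDl exprn_ge0.
  exists N => m n /PN Pm /PN Pn.
  rewrite -(ltr_pM2l q1').
  have := ler_wpM2l (ltW q1') (ler_rnormB (P m - P N) (P n - P N)).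
  rewrite opprB addrA subrK => /le_lt_trans; apply.
  have := qN N (leqnn N); rewrite ltr_pdivlMr// => qNe.
  by have := exprn_ge0 N q0; lra.
exists y; apply: Gcl GP Py _; apply/cvg_rnormP => e e0.
have [|N qN] := q_small (e / (rnorm z + 1)).
  by rewrite divr_gt0// ltr_wpDl// rnorm_ge0.
exists N => n /qN; rewrite ltr_pdivlMr ?ltr_wpDl ?rnorm_ge0// => qn.
rewrite opprB addrC subrK; apply: le_lt_trans (r_le n) _.
by have := exprn_ge0 n q0; lra.
Qed.

Lemma rel_add_linear A B : linear_relation A -> linear_relation B ->
  linear_relation (rel_add A B).
Proof.
move=> linA linB; split.
- by exists 0, 0; split; [case: linA|case: linB|rewrite addr0].
- move=> [x h] [x' h'] [f [g [/= Af Bg ->]]] [f' [g' [/= Af' Bg' ->]]].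
  exists (f + f'), (g + g'); split; [exact: linrelD|exact: linrelD|].
  exact: addrACA.
- move=> c [x h] [f [g [/= Af Bg ->]]]; exists (c *: f), (c *: g).
  by split; [exact: linrelZ|exact: linrelZ|exact: scalerDr].
Qed.

Lemma rel_add_hermitian A B : hermitian_rel ip A -> hermitian_rel ip B ->
  hermitian_rel ip (rel_add A B).
Proof.
move=> hA hB [x h] [f [g [/= Af Bg ->]]] y _ [f' [g' [/= Af' Bg' ->]]] /=.
by rewrite linearDl linearDr; congr (_ + _);
  [exact: hA Af _ _ Af'|exact: hB Bg _ _ Bg'].
Qed.

(** With y = f - i mu x, finding h in (A + B)(x) with h - i mu x = z amounts to
   writing z = y + g + n with g in [B x] and n in [A 0].  The relation [G]
   between y and z so defined is closed although [B] need not be: changing y by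
   a small amount changes g, up to an element of [B 0] that n absorbs, by a
   small amount. *)
Lemma perturbed_range A B (a b : R) mu :
  linear_relation A -> linear_relation B -> selfadjoint_rel ip A ->
  rel_at B 0 `<=` rel_at A 0 ->
  0 <= a -> 0 <= b -> mu != 0 -> a / `|mu| + b < 1 ->
  (forall x f, A (x, f) -> forall e : R, 0 < e ->
    exists2 g, B (x, g) & rnorm g <= a * rnorm x + b * rnorm f + e) ->
  forall z, exists x h, rel_add A B (x, h) /\ h - (mu *i) *: x = z.
Proof.
move=> linA linB saA B0A0 a0 b0 mu0 q1 bound.
have hA : hermitian_rel ip A by rewrite /hermitian_rel -saA.
set q' := a / `|mu| + b in q1; pose q := (q' + 1) / 2.
have q'0 : 0 <= q' by rewrite addr_ge0// divr_ge0.
(* [q' < q] leaves room for the additive error [e] of [bound] *)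
have small x f : A (x, f) ->
    exists2 g, B (x, g) & rnorm g <= q * rnorm (f - (mu *i) *: x).
  move=> Axf; have [f_le x_le] := hermitian_ge_rnorm mu linA hA Axf.
  have [y0|y0] := eqVneq (rnorm (f - (mu *i) *: x)) 0.
    have x0 : x = 0.
      apply/rnorm_eq0/eqP; rewrite eq_le rnorm_ge0 andbT.
      by move: x_le; rewrite y0 pmulr_rle0// normr_gt0.
    by exists 0; [rewrite x0; case: linB|rewrite y0 rnorm0 mulr0].
  have {}y0 : 0 < rnorm (f - (mu *i) *: x) by rewrite lt_def y0 rnorm_ge0.
  have [|g Bg g_le] := bound _ _ Axf ((1 - q') / 2 * rnorm (f - (mu *i) *: x)).
    by rewrite mulr_gt0// divr_gt0// subr_gt0.
  exists g => //; apply: le_trans g_le _.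
  have ax : a * rnorm x <= a / `|mu| * rnorm (f - (mu *i) *: x).
    by rewrite -mulrA ler_wpM2l// ler_pdivlMl ?normr_gt0.
  have bf := ler_wpM2l b0 f_le.
  by rewrite /q /q' in ax bf *; lra.
have ran := selfadjoint_range linA saA mu0.
pose G := [set p : X * X | exists x f g n,
  [/\ A (x, f), B (x, g), A (0, n), f - (mu *i) *: x = p.1 &
      p.2 = p.1 + g + n]].
suff Gsurj z : exists y, G (y, z).
  move=> z; have [y [x [f [g [n [Axf Bxg A0n /= fx ->]]]]]] := Gsurj z.
  exists x, (f + n + g); split; last first.
    by rewrite -fx [LHS]addrAC [RHS]addrAC (addrAC f n).
  exists (f + n), g; split=> //=; by rewrite -[x]addr0; exact: linrelD.
move: z; apply: (approx_solvable (C := 1) (q := q)).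
- exists 0, 0, 0, 0; rewrite scaler0 subr0 !addr0.
  by case: linA; case: linB.
- move=> [y z1] [y' z1'] [x [f [g [n [Axf Bxg A0n /= fx ->]]]]].
  move=> [x' [f' [g' [n' [Axf' Bxg' A0n' /= fx' ->]]]]].
  exists (x + x'), (f + f'), (g + g'), (n + n'); split; try exact: linrelD.
  + by rewrite -[0]addr0; exact: linrelD.
  + by rewrite scalerDr opprD addrACA fx fx'.
  + by rewrite -[LHS]/(y + g + n + (y' + g' + n')) addrACA (addrACA y).
- move=> u v y z1 Guv uy vz; have [x [f [Axf fx]]] := ran y.
  have [g0 Bxg _] := small _ _ Axf.
  (* [d k] is a small representative of g - g_k modulo [B 0] *)
  have /choice[d Ad] k : exists d, rnorm d <= q * rnorm (y - u k) /\
      A (0, v k - u k - g0 + d).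
    have [xk [fk [gk [nk [Ak Bk A0n /= fk_xk ->]]]]] := Guv k.
    have [d Bd d_le] := small _ _ (linrelB linA Axf Ak); exists d; split.
      move: d_le; rewrite (_ : _ - _ - _ = y - u k)// -fx -fk_xk.
      by rewrite scalerBr !opprD !opprK addrACA.
    have : rel_at B 0 (g0 - gk - d).
      by have := linrelB linB (linrelB linB Bxg Bk) Bd; rewrite subrr.
    move=> /B0A0 As; have := linrelB linA A0n As; rewrite subrr.
    congr (A (_, _)); rewrite !opprB addrC (addrC d).
    rewrite [in RHS](addrAC _ nk) (addrAC (u k)) subrr add0r (addrAC gk nk).
    by rewrite [in LHS]addrAC.
  exists x, f, g0, (z1 - y - g0); split=> //=; last first.
    by rewrite -(addrA z1) -opprD subrKC.
  rewrite saA; apply: (adjoint_closed linA (u := fun=> 0)).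
  + move=> k; rewrite -saA; exact: (Ad k).2.
  + exact: cvg_cst.
  + apply/cvg_rnormP => e e0.
    have [|N Nu] := (cvg_rnormP _ _).1 uy (e / (2 * (q + 1))).
      by rewrite divr_gt0// /q; lra.
    have [M Mv] := (cvg_rnormP _ _).1 vz (e / 2) (divr_gt0 e0 (ltr0n _ 2)).
    exists (maxn N M) => n; rewrite geq_max => /andP[/Nu un /Mv vn].
    rewrite (_ : _ - _ = (z1 - v n) - (y - u n) - d n); last first.
      rewrite opprD addrA; congr (_ - _).
      by rewrite !opprD !opprK addrACA addNr addr0 addrACA.
    apply: le_lt_trans (ler_rnormB _ _) _.
    have := ler_rnormB (z1 - v n) (y - u n); have [d_le _] := Ad n.
    move: un; rewrite ltr_pdivlMr; last by rewrite /q; lra.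
    have := rnorm_ge0 (y - u n); lra.
- exact: ler01.
- by rewrite /q; lra.
- move=> z; have [x [f [Axf fx]]] := ran z; have [g Bg g_le] := small _ _ Axf.
  exists z, (z + g); split.
  + by exists x, f, g, 0; rewrite addr0; split=> //; case: linA.
  + by rewrite mul1r.
  + by rewrite opprD addrA subrr add0r rnormN -fx.
Qed.

Lemma selfadjoint_perturbation A B (a b : R) :
  linear_relation A -> linear_relation B ->
  selfadjoint_rel ip A -> hermitian_rel ip B ->
  rel_at B 0 `<=` rel_at A 0 -> 0 <= a -> 0 <= b < 1 ->
  (forall x f, A (x, f) -> forall e : R, 0 < e ->
    exists2 g, B (x, g) & rnorm g <= a * rnorm x + b * rnorm f + e) ->
  selfadjoint_rel ip (rel_add A B).
Proof.
move=> linA linB saA hB B0A0 a0 /andP[b0 b1] bound.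
(* [a + 1] rather than [a] keeps [mu] nonzero *)
pose mu := (a + 1) / (1 - b).
have b1' : 0 < 1 - b by rewrite subr_gt0.
have mu0 : 0 < mu by rewrite divr_gt0// ltr_wpDl.
have small : a / mu + b < 1.
  by rewrite -ltrBrDr ltr_pdivrMr// /mu mulrC mulfVK ?gt_eqF// ltrDl.
apply: (range_selfadjoint (mu := mu)).
- exact: rel_add_linear.
- by apply: rel_add_hermitian hB; rewrite /hermitian_rel -saA.
- by apply: perturbed_range bound; rewrite ?gt_eqF ?gtr0_norm.
- by apply: perturbed_range bound; rewrite ?oppr_eq0 ?gt_eqF ?normrN ?gtr0_norm.
Qed.

(** * The norm of a relation at a point *)

Lemma rel_norm_le T x f : linear_relation T -> T (x, f) -> rel_norm T x <= rnorm f.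
Proof.
move=> linT Txf; rewrite (rel_normE linT Txf); apply: ge_inf.
  by exists 0 => _ [n _ <-]; exact: rnorm_ge0.
by exists 0; [apply: subset_closure; case: linT|rewrite addr0].
Qed.

(** The infimum defining [rel_norm] runs over the closure of [T 0]; density
   replaces its elements by elements of [T 0], at the cost of another [e / 2]. *)
Lemma rel_norm_approx T x (e : R) : linear_relation T -> rel_dom T x -> 0 < e ->
  exists2 f, T (x, f) & rnorm f < rel_norm T x + e.
Proof.
move=> linT [f Txf] e0; rewrite (rel_normE linT Txf).
set E := [set _ | _ in _]; have e2 : 0 < e / 2 by rewrite divr_gt0.
have E0 : has_inf E.
  split; last by exists 0 => _ [n _ <-]; exact: rnorm_ge0.
  by exists (rnorm (f + 0)), 0 => //; apply: subset_closure; case: linT.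
have [_ [n clTn <-] fn] := inf_adherent e2 E0.
have e2' : 0 < (e / 2)%:C by rewrite ltcR.
have [m [Tm]] := clTn _ (nbhsx_ballx n _ e2').
rewrite -ball_normE /ball_/= normE ltcR => nm.
exists (f + m); first by rewrite -[x]addr0; exact: linrelD.
have := ler_rnormB (f + n) (n - m); rewrite opprB (addrC m) addrA addrK.
by move: fn nm; lra.
Qed.

(** * The pencil T + t S *)

Definition rel_scale t S : set (X * X) :=
  [set p | exists2 g, S (p.1, g) & p.2 = t%:C *: g].

Lemma rel_scale_linear t S : linear_relation S -> linear_relation (rel_scale t S).
Proof.
move=> linS; split.
- by exists 0; [case: linS|rewrite scaler0].
- move=> [x h] [x' h'] [g /= Sg ->] [g' /= Sg' ->].
  by exists (g + g'); [exact: linrelD|rewrite scalerDr].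
- move=> c [x h] [g /= Sg ->]; exists (c *: g); first exact: linrelZ.
  by rewrite [RHS]scalerA mulrC -scalerA.
Qed.

Lemma rel_scale_hermitian t S : linear_relation S -> hermitian_rel ip S ->
  hermitian_rel ip (rel_scale t S).
Proof.
move=> linS hS [x h] [g /= Sg ->]; apply/adjointP; first exact: rel_scale_linear.
move=> y _ [g' /= Sg' ->]; rewrite ripZl ripZr; congr (_ * _).
exact: (adjointP _ _ linS).1 (hS _ Sg) _ _ Sg'.
Qed.

Lemma rel_scale1 S : rel_scale 1 S = S.
Proof.
apply/seteqP; split=> [[x h] [g /= Sg ->]|[x h] Sh]; rewrite ?scale1r//.
by exists h; rewrite ?scale1r.
Qed.

Section Pencil.
Variables T S : set (X * X).
Hypotheses (linT : linear_relation T) (linS : linear_relation S).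
Hypothesis hS : hermitian_rel ip S.
Hypotheses (TS : rel_dom T `<=` rel_dom S) (S0T0 : rel_at S 0 `<=` rel_at T 0).

Definition pencil t := rel_add T (rel_scale t S).

Lemma pencil_shift x f g g' t : T (x, f) -> S (x, g) -> S (x, g') ->
  T (x, f + t%:C *: (g - g')).
Proof.
move=> Tf Sg Sg'; have := linrelB linS Sg Sg'; rewrite subrr => /S0T0.
by move=> /(linrelZ t%:C linT) /(linrelD linT Tf); rewrite scaler0 addr0.
Qed.

Lemma pencil1 : pencil 1 = rel_add T S.
Proof. by rewrite /pencil rel_scale1. Qed.

(** [0 S] is the zero operator restricted to the domain of [S], so adding it to
   [T] loses nothing when that domain contains the one of [T]. *)
Lemma pencil0 : pencil 0 = T.
Proof.
apply/seteqP; split=> [[x h] [f [_ [/= Tf [g /= _ ->] ->]]]|[x f] Tf].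
  by rewrite scale0r addr0.
have [g Sg] : rel_dom S x by apply: TS; exists f.
by exists f, 0; split=> //=; [exists g; rewrite ?scale0r|rewrite addr0].
Qed.

Lemma pencilD t s : rel_add (pencil t) (rel_scale s S) = pencil (t + s).
Proof.
apply/seteqP; split=> [[x h]|[x h]].
  move=> [_ [_ [/= [f [_ [/= Tf [g /= Sg ->] ->]]] [g' /= Sg' ->] ->]]].
  exists (f + s%:C *: (g' - g)), ((t + s)%:C *: g).
  split; [exact: pencil_shift|by exists g|].
  rewrite /= rmorphD scalerDl -!addrA; congr (_ + _).
  by rewrite scalerBr addrCA subrK.
move=> [f [_ [/= Tf [g /= Sg ->] ->]]].
exists (f + t%:C *: g), (s%:C *: g); split=> /=.
- by exists f, (t%:C *: g); split=> //; exists g.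
- by exists g.
- by rewrite rmorphD scalerDl addrA.
Qed.

Lemma pencil_at0 t : rel_at T 0 `<=` rel_at (pencil t) 0.
Proof.
move=> n Tn; exists n, 0; split; rewrite ?addr0//=.
by exists 0; [case: linS|rewrite scaler0].
Qed.

(** Replacing the given value [g] of [S] at [x] by a nearly shortest one [g']
   moves f within [T x], so that |f'| <= |h| + t |g'| for some f' in [T x]. *)
Lemma rel_norm_le_pencil t x h : 0 <= t -> pencil t (x, h) ->
  rel_norm T x <= rnorm h + t * rel_norm S x.
Proof.
move=> t0 [f [_ [/= Tf [g /= Sg ->] ->]]].
apply/ler_addgt0Pr => e e0.
have t1 : 0 < t + 1 by lra.
have [|g' Sg' g'_le] := rel_norm_approx (e := e / (t + 1)) linS (ex_intro _ g Sg).
  by rewrite divr_gt0.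
apply: le_trans (rel_norm_le linT (pencil_shift t Tf Sg Sg')) _.
rewrite (_ : _ + _ = f + t%:C *: g - t%:C *: g'); last by rewrite scalerBr addrA.
apply: le_trans (ler_rnormB _ _) _; rewrite rnormZ ger0_norm// -addrA lerD2l.
have := ler_wpM2l t0 (ltW g'_le); have : t * (e / (t + 1)) <= e.
  by rewrite mulrA ler_pdivrMr//; lra.
by lra.
Qed.

(** From |S x| <= a |x| + b |T x| and |T x| <= |h| + t |S x| one gets
   (1 - t b) |S x| <= a |x| + b |h|, so [s S] is a small perturbation of
   [T + t S] as soon as |s| b < 1 - t b. *)
Lemma pencil_step (a b t s : R) : 0 <= a -> 0 <= b -> 0 <= t ->
  (forall x, rel_dom T x -> rel_norm S x <= a * rnorm x + b * rel_norm T x) ->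
  `|s| * b < 1 - t * b ->
  selfadjoint_rel ip (pencil t) -> selfadjoint_rel ip (pencil (t + s)).
Proof.
move=> a0 b0 t0 bound sb sa; rewrite -pencilD.
have d0 : 0 < 1 - t * b by apply: le_lt_trans sb; rewrite mulr_ge0.
apply: (selfadjoint_perturbation (a := `|s| * a / (1 - t * b))
  (b := `|s| * b / (1 - t * b))) => //.
- exact/rel_add_linear/rel_scale_linear.
- exact: rel_scale_linear.
- exact: rel_scale_hermitian.
- move=> _ [g /= Sg ->]; apply: pencil_at0.
  by have := linrelZ s%:C linS Sg; rewrite scaler0 => /S0T0.
- by rewrite divr_ge0 ?mulr_ge0// ltW.
- by rewrite divr_ge0 ?mulr_ge0 ?(ltW d0)// ltr_pdivrMr// mul1r.
move=> x h Ph e e0; have Tx : rel_dom T x by case: Ph => f [_ [Tf _ _]]; exists f.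
have s1 : 0 < `|s| + 1 by rewrite ltr_wpDl.
have [|g Sg g_le] := rel_norm_approx (e := e / (`|s| + 1)) linS (TS Tx).
  by rewrite divr_gt0.
exists (s%:C *: g); first by exists g.
have S_le : rel_norm S x <= (a * rnorm x + b * rnorm h) / (1 - t * b).
  rewrite ler_pdivlMr//; have := bound _ Tx.
  have := ler_wpM2l b0 (rel_norm_le_pencil t0 Ph); lra.
rewrite rnormZ; apply: le_trans (ler_wpM2l (normr_ge0 s) (ltW g_le)) _.
have := ler_wpM2l (normr_ge0 s) S_le; have : `|s| * (e / (`|s| + 1)) <= e.
  by rewrite mulrA ler_pdivrMr//; have := normr_ge0 s; lra.
by lra.
Qed.

(** One step goes from [0] to [1]; going back, steps of length [1 / N] with
   b / N < 1 - b work from every [t] in [0, 1]. *)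
Lemma pencil_selfadjoint_iff (a b : R) : 0 <= a -> 0 <= b < 1 ->
  (forall x, rel_dom T x -> rel_norm S x <= a * rnorm x + b * rel_norm T x) ->
  selfadjoint_rel ip (pencil 1) <-> selfadjoint_rel ip (pencil 0).
Proof.
move=> a0 /andP[b0 b1] bound; split=> sa; last first.
  rewrite -[1]add0r; apply: (pencil_step a0 b0 _ bound) sa => //.
  by rewrite normr1; lra.
pose N := (Num.truncn (b / (1 - b))).+1.
have N_gt : b < (1 - b) * N%:R.
  by rewrite -ltr_pdivrMl ?subr_gt0// mulrC; exact: truncnS_gt.
have N0 : 0 < N%:R :> R by rewrite ltr0n.
suff down k : (k <= N)%N -> selfadjoint_rel ip (pencil (1 - k%:R / N%:R)).
  by have := down N (leqnn N); rewrite divff ?gt_eqF// subrr.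
elim: k => [|k IH] kN; first by rewrite mul0r subr0.
rewrite (_ : 1 - _ = 1 - k%:R / N%:R + - N%:R^-1); last first.
  by rewrite -addn1 natrD; field; rewrite gt_eqF.
have k0 : 0 <= k%:R / N%:R :> R by rewrite divr_ge0.
have t0 : 0 <= 1 - k%:R / N%:R :> R.
  by rewrite subr_ge0 ler_pdivrMr// mul1r ler_nat ltnW.
apply: (pencil_step a0 b0 t0 bound); last exact/IH/ltnW.
rewrite normrN ger0_norm ?invr_ge0// mulrC; apply: (@lt_le_trans _ _ (1 - b)).
  by rewrite ltr_pdivrMr.
by rewrite lerD2l lerN2 ler_piMl// gerBl.
Qed.

End Pencil.

Lemma rel_bound_lt1 S T : rel_bounded S T -> rel_bound S T < 1 ->
  exists a b : R, [/\ 0 <= a, 0 <= b < 1 &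
    forall x, rel_dom T x -> rel_norm S x <= a * rnorm x + b * rel_norm T x].
Proof.
move=> [_ [c c0 c_bound]] lt1; rewrite /rel_bound in lt1.
set E := [set _ | _] in lt1.
have E0 : has_inf E.
  split; last by exists 0 => b [].
  by exists c; split=> //; exists c => // x /c_bound; rewrite mulrDr.
have [|b [b0 [a a0 ab]]] := @inf_adherent _ E (1 - inf E) _ E0.
  by rewrite subr_gt0.
by rewrite subrKC => b1; exists a, b; rewrite b0.
Qed.

End RealInnerProduct.

Theorem theorem3p1 (R : realType) (X : completeNormedModType R[i])
    (ip : {dot X for conjC}) (ip_norm : induces_norm ip)
    (S T : set (X * X))
    (S_lin : linear_relation S) (T_lin : linear_relation T)
    (S_herm : hermitian_rel ip S) (T_herm : hermitian_rel ip T)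
    (domTS : rel_dom T `<=` rel_dom S)
    (S0T0 : rel_at S 0 `<=` rel_at T 0)
    (S_bounded : rel_bounded S T) (S_bound : rel_bound S T < 1) :
  selfadjoint_rel ip (rel_add T S) <-> selfadjoint_rel ip T.
Proof.
have [a [b [a0 b01 bound]]] := rel_bound_lt1 S_bounded S_bound.
rewrite -pencil1 -[in X in _ <-> X](pencil0 domTS).
exact: pencil_selfadjoint_iff bound.
Qed.
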